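(* Let $s>1$ be an integer, let $p_1,\dots,p_s$ be distinct prime numbers with $p_1,\dots,p_{s-1}$ odd, and let $r_1,\dots,r_s$ be positive integers; if $p_s=2$, assume also that $r_s=1$. Let $r_i'$ be integers with $0\le r_i'\le r_i$ for $1\le i\le s$. Then there exists a simple left brace whose additive group is isomorphic to $$(\mathbb{Z}/(p_1^{r_1}))^{p_1^{r'_1}(p_2^{r_2}-1)+1}\times\cdots\times(\mathbb{Z}/(p_{s-1}^{r_{s-1}}))^{p_{s-1}^{r'_{s-1}}(p_s^{r_s}-1)+1}\times(\mathbb{Z}/(p_{s}^{r_{s}}))^{p_{s}^{r'_{s}}(p_1^{r_1}-1)+1}.$$
   Context: A left brace is a set $B$ with operations $+,\cdot$ such that $(B,+)$ is an abelian group, $(B,\cdot)$ is a group and $a\cdot(b+c)+a=a\cdot b+a\cdot c$ for all $a,b,c\in B$. Put $\lambda_a(b)=ab-a$. An ideal of $B$ is a normal subgroup $I$ of $(B,\cdot)$ with $\lambda_b(a)\in I$ for all $a\in I$, $b\in B$. $B$ is simple if it is nonzero and its only ideals are $\{0\}$ and $B$. *)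

(* Defs.v *)
From HB Require Import structures.
From mathcomp Require Import all_boot all_order all_algebra.
From mathcomp Require Import classical_sets.

Set Implicit Arguments.
Unset Strict Implicit.
Unset Printing Implicit Defensive.

Import GRing.Theory.
Local Open Scope ring_scope.

(* The additive structure is in ring_scope (x + y, 0), the multiplicative one
   in group_scope ((x * y)%g, 1%g, (x^-1)%g); the two instances are unrelated
   a priori. *)
HB.mixin Record isLeftBrace B of GRing.Zmodule B & Group B := {
  brace_distr : forall a b c : B,
    (a * (b + c)%R)%g + a = (a * b)%g + (a * c)%g
}.

#[short(type="leftBraceType")]
HB.structure Definition LeftBrace :=
  {B of isLeftBrace B & GRing.Zmodule B & Group B}.

Definition brace_lambda (B : leftBraceType) (a b : B) : B := (a * b)%g - a.

Definition normal_subgroup (G : groupType) (I : set G) : Prop :=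
  [/\ I 1%g,
      forall x y, I x -> I y -> I (x * y)%g,
      forall x, I x -> I (x^-1)%g
    & forall g x, I x -> I (x ^ g)%g].

Definition brace_ideal (B : leftBraceType) (I : set B) : Prop :=
  normal_subgroup I /\ forall a b : B, I a -> I (brace_lambda b a).

Definition simple_brace (B : leftBraceType) : Prop :=
  (exists x : B, x != 0) /\
  forall I : set B, brace_ideal I -> I = [set 0]%classic \/ I = setT.

(* MathComp has a canonical zmodType on {ffun I -> V} only for a constant V. *)
Definition zmod_prod (I : finType) (V : I -> zmodType) : Type :=
  {dffun forall i : I, V i}.

Section ZmodProd.
Context (I : finType) (V : I -> zmodType).
Implicit Types f g h : zmod_prod V.

HB.instance Definition _ := Choice.on (zmod_prod V).

Definition zmod_prod_zero : zmod_prod V := [ffun i => 0 : V i].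
Definition zmod_prod_opp f : zmod_prod V := [ffun i => - f i].
Definition zmod_prod_add f g : zmod_prod V := [ffun i => f i + g i].

Fact zmod_prod_addA : associative zmod_prod_add.
Proof. by move=> f g h; apply/ffunP=> i; rewrite !ffunE addrA. Qed.

Fact zmod_prod_addC : commutative zmod_prod_add.
Proof. by move=> f g; apply/ffunP=> i; rewrite !ffunE addrC. Qed.

Fact zmod_prod_add0 : left_id zmod_prod_zero zmod_prod_add.
Proof. by move=> f; apply/ffunP=> i; rewrite !ffunE add0r. Qed.

Fact zmod_prod_addN : left_inverse zmod_prod_zero zmod_prod_opp zmod_prod_add.
Proof. by move=> f; apply/ffunP=> i; rewrite !ffunE addNr. Qed.

HB.instance Definition _ := GRing.isZmodule.Build (zmod_prod V)
  zmod_prod_addA zmod_prod_addC zmod_prod_add0 zmod_prod_addN.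

End ZmodProd.

Definition zmod_isomorphic (U V : zmodType) : Prop :=
  exists f : {additive U -> V}, bijective f.

(* Main.v *)
Require Import Defs.
From HB Require Import structures.
From mathcomp Require Import all_boot all_order all_algebra.
From mathcomp Require Import boolp classical_sets.

Set Implicit Arguments.
Unset Strict Implicit.
Unset Printing Implicit Defensive.

Import GRing.Theory.
Local Open Scope ring_scope.

(** The brace is a cycle of layers, one for each prime.  Write [R_i] for
    [Z/(p_i^r_i)] and let layer [i] be [V_i x R_i], where [V_i] carries a
    quadratic form [Q_i] with values in [R_i] and polar form [b_i], and where the
    additive group of the next ring, [R_(i+1)], acts on [V_i] by isometries.
    For [a = (x_i, mu_i)_i] put [dev_i a = mu_i - Q_i(x_i)], and let [a] act on
    layer [i] by
      [(y, nu) |-> (g y, nu + b_i(x_i, g y))],  [g] the action of [dev_(i+1) a].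
    Since [Q_i(x + g y) = Q_i(x) + Q_i(y) + b_i(x, g y)], the function [dev] is
    additive along [a + lambda_a(b)] (lemma [dev_mul]); hence
    [lambda_(a + lambda_a(b)) = lambda_a lambda_b], which is what makes
    [a b = a + lambda_a(b)] a left brace.

    Simplicity ([cycle_brace_simple]) holds when every layer satisfies three
    conditions: [b_i] is nondegenerate; each nonzero [k] in [R_(i+1)] moves some
    [y] so that [b_i(-, k y - y)] is onto; the differences [k y - y] span [V_i].
    An ideal contains [lambda_b(a)] and [lambda_a(b) - b] for each of its elements
    [a].  Multiplying a nonzero element by a suitable integer puts it in a single
    layer; nondegeneracy turns it into some [(0, k)] with [k] nonzero in layer
    [i+1]; this moves layer [i], so that the ideal contains [(k y - y, 0)] and
    then all [(0, t)] there; going around the cycle every [R_i] is in the ideal,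
    and then every [V_i] by the spanning condition.

    For [V_i] take the functions [T x K -> R_i] whose sum over each fibre
    [{t} x K] vanishes, where [K] is the additive group of [R_(i+1)] and [T] has
    [p_i^r'_i] elements: this is [p_i^r'_i] copies of the augmentation module of
    [R_i[K]], free of rank [p_i^r'_i * (p_(i+1)^r_(i+1) - 1)].  The group [K] acts
    by translation, and [Q_i] is the sum over [T] of the second elementary
    symmetric function, whose polar form on such functions is minus the standard
    scalar product, even when [2] is not invertible.  The three conditions follow
    because [#|K|] is invertible in [R_i]: the mean can be subtracted from any
    function, and [- #|K| y] is the sum of the [k y - y]. *)

(** * Ideals of left braces *)

Section IdealTheory.
Context (B : leftBraceType).
Implicit Types a b c : B.

Lemma brace_one : (1%g : B) = 0.
Proof.
have mulg0 a : (a * 0)%g = a.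
  apply: (addrI (a * 0)%g); have := brace_distr a (0 : B) 0.
  by rewrite addr0 => <-.
by rewrite -[LHS]mulg0 mul1g.
Qed.

Lemma brace_mulE a b : (a * b)%g = a + brace_lambda a b.
Proof. by rewrite addrC subrK. Qed.

Lemma brace_addE a b : a + b = (a * brace_lambda a^-1%g b)%g.
Proof.
have lE : brace_lambda a^-1%g b + a^-1%g = (a^-1 * b)%g by rewrite subrK.
have := brace_distr a (brace_lambda a^-1%g b) a^-1%g.
rewrite lE mulgA mulgV mul1g brace_one addr0 => <-; exact: addrC.
Qed.

Context (I : set B) (I_ideal : brace_ideal I).

Lemma ideal_lambda a b : I a -> I (brace_lambda b a).
Proof. by case: I_ideal => _; apply. Qed.

Lemma ideal0 : I 0.
Proof. by rewrite -brace_one; case: I_ideal => -[]. Qed.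

Lemma idealD a b : I a -> I b -> I (a + b).
Proof.
move=> Ia Ib; rewrite brace_addE; case: I_ideal => -[_ IM _ _] _.
by apply: IM => //; apply: ideal_lambda.
Qed.

Lemma idealN a : I a -> I (- a).
Proof.
move=> Ia; have -> : - a = brace_lambda a a^-1%g.
  by rewrite /brace_lambda mulgV brace_one add0r.
by apply: ideal_lambda; case: I_ideal => -[_ _ IV _] _; apply: IV.
Qed.

Lemma idealB a b : I a -> I b -> I (a - b).
Proof. by move=> Ia Ib; apply: idealD => //; apply: idealN. Qed.

Lemma idealMn a n : I a -> I (a *+ n).
Proof.
move=> Ia; elim: n => [|n IHn]; first by rewrite mulr0n; apply: ideal0.
by rewrite mulrS; apply: idealD.
Qed.

Lemma ideal_sum (J : finType) (P : pred J) (F : J -> B) :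
  (forall j, P j -> I (F j)) -> I (\sum_(j | P j) F j).
Proof. by move=> IF; apply: big_ind => //; [apply: ideal0 | apply: idealD]. Qed.

(** [B / I] is a brace in which [a] becomes trivial: conjugating [a] by [b] turns
    [a b] into [b (a ^ b)], and the two sides expand additively. *)
Lemma ideal_lambda_sub a b : I a -> I (brace_lambda a b - b).
Proof.
move=> Ia; have -> : brace_lambda a b - b = brace_lambda b (a ^ b)%g - a.
  have E : a + brace_lambda a b = b + brace_lambda b (a ^ b)%g.
    by rewrite -!brace_mulE conjgE mulVKg.
  by rewrite -[X in X - b](addKr a) E addrA addrAC addrK addrC.
apply: idealB => //; apply: ideal_lambda.
by case: I_ideal => -[_ _ _ IJ] _; apply: IJ.
Qed.

End IdealTheory.

(** * The left brace of a lambda map *)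

(** The axioms [lmapD] and [lmapM] say that [a b = a + lmap a b] is associative
    and satisfies the brace law; [linv] gives right inverses, from which left
    inverses follow. *)
Record lambda_map (A : zmodType) := LambdaMap {
  lmap :> A -> A -> A;
  linv : A -> A;
  lmapD : forall a b c, lmap a (b + c) = lmap a b + lmap a c;
  lmapM : forall a b c, lmap (a + lmap a b) c = lmap a (lmap b c);
  lmap0 : forall b, lmap 0 b = b;
  lmapV : forall a, a + lmap a (linv a) = 0
}.

(** A copy of [A], so that the group structure may depend on [L]. *)
Definition lambda_brace (A : zmodType) (L : lambda_map A) : Type := A.

Section LambdaBrace.
Context (A : zmodType) (L : lambda_map A).
Implicit Types a b c : lambda_brace L.

HB.instance Definition _ := GRing.Zmodule.on (lambda_brace L).

Definition lbmul a b : lambda_brace L := a + L a b.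
Definition lbinv a : lambda_brace L := linv L a.

Fact lbmulA : associative lbmul.
Proof. by move=> a b c; rewrite /lbmul lmapM lmapD addrA. Qed.

Fact lbmul0b : left_id 0 lbmul.
Proof. by move=> b; rewrite /lbmul lmap0 add0r. Qed.

Fact lbmulb0 : right_id 0 lbmul.
Proof.
move=> a; rewrite /lbmul; apply: (addIr (L a 0)).
by rewrite -addrA -lmapD addr0.
Qed.

Fact lbmulbV : right_inverse 0 lbinv lbmul.
Proof. by move=> a; exact: (@lmapV A L a). Qed.

Fact lbmulVb : left_inverse 0 lbinv lbmul.
Proof.
move=> a; rewrite -[LHS]lbmulb0 -[in LHS](lbmulbV (lbinv a)) lbmulA.
by rewrite -(lbmulA (lbinv a) a) lbmulbV lbmulb0 lbmulbV.
Qed.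

HB.instance Definition _ := isGroup.Build (lambda_brace L)
  lbmulA lbmul0b lbmulb0 lbmulVb lbmulbV.

Fact lb_mulE a b : (a * b)%g = a + L a b.
Proof. by []. Qed.

Fact lb_distr a b c : (a * (b + c)%R)%g + a = (a * b)%g + (a * c)%g.
Proof. by rewrite !lb_mulE lmapD -!addrA; do 2 congr (_ + _); rewrite addrC. Qed.

HB.instance Definition _ := isLeftBrace.Build (lambda_brace L) lb_distr.

Lemma lambda_braceE a b : brace_lambda a b = L a b.
Proof. by rewrite /brace_lambda lb_mulE addrC addKr. Qed.

End LambdaBrace.

(** * Quadratic forms with an isometric action *)

Definition polar (V R : zmodType) (Q : V -> R) (x y : V) : R :=
  Q (x + y) - Q x - Q y.

(** A quadratic form in the weak sense needed here: no scalars are involved, so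
    only the biadditivity of the polar form is recorded. *)
Record isometric_action (K V R : zmodType) := IsometricAction {
  quad : V -> R;
  act : K -> V -> V;
  polarDr : forall x y z, polar quad x (y + z) = polar quad x y + polar quad x z;
  act0 : forall x, act 0 x = x;
  actD : forall k l x, act (k + l) x = act k (act l x);
  act_add : forall k x y, act k (x + y) = act k x + act k y;
  quad_act : forall k x, quad (act k x) = quad x
}.

Section IsometricActionTheory.
Context (K V R : zmodType) (D : isometric_action K V R).
Implicit Types (k l : K) (x y z : V).
Local Notation b := (polar (quad D)).

Lemma polarC x y : b x y = b y x.
Proof. by rewrite /polar (addrC x) addrAC. Qed.

Lemma polarDl x y z : b (x + y) z = b x z + b y z.
Proof. by rewrite !(polarC _ z) polarDr. Qed.

Lemma polarx0 x : b x 0 = 0.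
Proof. by apply: (addrI (b x 0)); rewrite -polarDr !addr0. Qed.

Lemma polar0x x : b 0 x = 0.
Proof. by rewrite polarC polarx0. Qed.

Lemma quad0 : quad D 0 = 0.
Proof.
by have := polarx0 0; rewrite /polar addr0 subrr sub0r => /eqP; rewrite oppr_eq0
  => /eqP.
Qed.

Lemma polarNr x y : b x (- y) = - b x y.
Proof. by apply: (addrI (b x y)); rewrite -polarDr !subrr polarx0. Qed.

Lemma quadD x y : quad D (x + y) = quad D x + quad D y + b x y.
Proof. by rewrite /polar -[_ - _ - _]addrA -opprD [RHS]addrC subrK. Qed.

Lemma actx0 k : act D k 0 = 0.
Proof. by apply: (addrI (act D k 0)); rewrite -act_add !addr0. Qed.

Lemma actVK k x : act D k (act D (- k) x) = x.
Proof. by rewrite -actD subrr act0. Qed.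

Lemma polar_act k x y : b (act D k x) (act D k y) = b x y.
Proof. by rewrite /polar -act_add !quad_act. Qed.

End IsometricActionTheory.

(** * The cycle of layers *)

Section Cycle.
Context (I : finType) (sg : I -> I) (V R : I -> zmodType).
Context (D : forall i, isometric_action (R (sg i)) (V i) (R i)).

Definition layer (i : I) : zmodType := (V i * R i)%type.

Local Notation A := (zmod_prod layer).
Implicit Types a b c : A.

Lemma zmod_prodP a b : (forall i, a i = b i) -> a = b.
Proof. by move=> ab; apply/ffunP. Qed.

Lemma zmod_prodDE a b i : (a + b) i = a i + b i.
Proof. by rewrite ffunE. Qed.

Lemma zmod_prod0E i : (0 : A) i = 0.
Proof. by rewrite ffunE. Qed.

Lemma zmod_prodNE a i : (- a) i = - a i.
Proof. by rewrite ffunE. Qed.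

(** The height of [a] above the graph of the quadratic form in layer [i]. *)
Definition dev a (i : I) : R i := (a i).2 - quad (D i) (a i).1.

Definition turn a (i : I) : V i -> V i := act (D i) (dev a (sg i)).

Definition cycle_lambda a b : A :=
  [ffun i => (turn a (b i).1,
              (b i).2 + polar (quad (D i)) (a i).1 (turn a (b i).1)) : layer i].

Definition cycle_inv a : A :=
  [ffun i => (act (D i) (- dev a (sg i)) (- (a i).1),
              polar (quad (D i)) (a i).1 (a i).1 - (a i).2) : layer i].

(** The polar term in the second coordinate of [cycle_lambda a b] is exactly the
    defect of additivity of the quadratic form. *)
Lemma dev_mul a b i : dev (a + cycle_lambda a b) i = dev a i + dev b i.
Proof.
rewrite /dev !ffunE /= quadD quad_act addrA.
by rewrite [quad _ _ + _ + _]addrC addrKA opprD addrACA.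
Qed.

Fact cycle_lambdaD a b c :
  cycle_lambda a (b + c) = cycle_lambda a b + cycle_lambda a c.
Proof.
apply: zmod_prodP => i; rewrite !ffunE /= /turn act_add polarDr.
by congr (_, _); rewrite addrACA.
Qed.

Fact cycle_lambdaM a b c :
  cycle_lambda (a + cycle_lambda a b) c = cycle_lambda a (cycle_lambda b c).
Proof.
apply: zmod_prodP => i; rewrite !ffunE /= /turn dev_mul actD; congr (_, _).
by rewrite polarDl polar_act -[RHS]addrA; congr (_ + _); apply: addrC.
Qed.

Fact cycle_lambda0 b : cycle_lambda 0 b = b.
Proof.
have d0 i : dev 0 i = 0 by rewrite /dev ffunE /= quad0 subrr.
apply: zmod_prodP => i; rewrite !ffunE /= /turn d0 act0 polar0x addr0.
by case: (b i).
Qed.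

Fact cycle_lambdaV a : a + cycle_lambda a (cycle_inv a) = 0.
Proof.
apply: zmod_prodP => i; rewrite !ffunE /= /turn actVK polarNr.
apply: injective_projections; rewrite /= ?subrr //.
by rewrite addrAC subrr sub0r subrr.
Qed.

Definition cycle_lambda_map : lambda_map A :=
  LambdaMap cycle_lambdaD cycle_lambdaM cycle_lambda0 cycle_lambdaV.

Definition cycle_brace : leftBraceType := lambda_brace cycle_lambda_map.

(** * Simplicity of the cycle brace *)

Definition at_layer i (w : layer i) : A :=
  [ffun j => dfwith (fun l => 0 : layer l) w j].

Lemma at_in i (w : layer i) : at_layer w i = w.
Proof. by rewrite ffunE dfwith_in. Qed.

Lemma at_out i j (w : layer i) : j != i -> at_layer w j = 0.
Proof. by move=> ji; rewrite ffunE dfwith_out // eq_sym. Qed.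

Lemma at_layerP i (w : layer i) a :
  a i = w -> (forall j, j != i -> a j = 0) -> a = at_layer w.
Proof.
move=> aiw a0; apply: zmod_prodP => j.
have [->|ji] := eqVneq j i; first by rewrite at_in.
by rewrite at_out ?a0.
Qed.

Lemma at_layerD i (w w' : layer i) : at_layer (w + w') = at_layer w + at_layer w'.
Proof.
apply/esym/at_layerP => [|j ji]; rewrite zmod_prodDE ?at_in //.
by rewrite !at_out ?addr0.
Qed.

Lemma at_layer0 i : at_layer (0 : layer i) = 0.
Proof. by apply/esym/at_layerP => [|j _]; rewrite zmod_prod0E. Qed.

Lemma zmod_prod_sumE (J : finType) (F : J -> A) i :
  (\sum_j F j) i = \sum_j F j i.
Proof.
by elim/big_rec2: _ => [|j x y _ <-]; rewrite ?zmod_prod0E ?zmod_prodDE.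
Qed.

Lemma sum_at_layer a : a = \sum_i at_layer (a i).
Proof.
apply: zmod_prodP => i; rewrite zmod_prod_sumE (bigD1 i) //= at_in big1 ?addr0 //.
by move=> j ji; rewrite at_out // eq_sym.
Qed.

Lemma at_layer0k i (k : R i) j : (at_layer ((0, k) : layer i) j).1 = 0.
Proof.
by have [->|ji] := eqVneq j i; rewrite ?at_in ?at_out.
Qed.

Lemma zmod_prodMnE a n i : (a *+ n) i = a i *+ n.
Proof.
by elim: n => [|n IHn]; rewrite ?mulr0n ?zmod_prod0E // !mulrS zmod_prodDE IHn.
Qed.

Section Ideal.
Context (J : set cycle_brace) (J_ideal : brace_ideal J).

(** The element [(z, Q z)] has height zero, so it acts on each [V j] trivially and
    only adds polar terms: [lambda_b a - a] keeps just one of them. *)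
Lemma ideal_polar i (w : layer i) z :
  J (at_layer w) -> J (at_layer ((0, polar (quad (D i)) z w.1) : layer i)).
Proof.
move=> Jw; set b : cycle_brace := at_layer ((z, quad (D i) z) : layer i).
have dev0 j : dev b j = 0.
  rewrite /dev; have [->|ji] := eqVneq j i; first by rewrite at_in subrr.
  by rewrite at_out // quad0 subrr.
have turnb j x : turn b x = x :> V j by rewrite /turn dev0 act0.
rewrite -(_ : brace_lambda b (at_layer w) - at_layer w = at_layer _).
  by apply: idealB => //; apply: ideal_lambda.
rewrite lambda_braceE.
apply: at_layerP => [|j ji]; rewrite zmod_prodDE zmod_prodNE ffunE !turnb.
  rewrite !at_in; apply: injective_projections; rewrite /= ?subrr //.
  by rewrite addrAC subrr add0r.
by rewrite at_out //= polarx0 addr0 subr0.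
Qed.

(** The element [(0, k)] of layer [sg j] has height [k] there, hence acts on
    [(y, 0)] in layer [j] through [k]. *)
Lemma ideal_act j (k : R (sg j)) (y : V j) :
  J (at_layer ((0, k) : layer (sg j))) ->
  J (at_layer ((act (D j) k y - y, 0) : layer j)).
Proof.
set a : cycle_brace := at_layer _ => Ja.
set b : cycle_brace := at_layer ((y, 0) : layer j).
rewrite -(_ : brace_lambda a b - b = at_layer _).
  exact: ideal_lambda_sub.
have deva : dev a (sg j) = k by rewrite /dev at_in /= quad0 subr0.
rewrite lambda_braceE.
apply: at_layerP => [|l lj]; rewrite zmod_prodDE zmod_prodNE ffunE at_layer0k.
  rewrite at_in polar0x /turn deva.
  by apply: injective_projections; rewrite /= ?addr0 ?subrr.
by rewrite at_out //= polar0x addr0 subr0 /turn actx0.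
Qed.

End Ideal.

(** The first two hypotheses say that [sg] is a cyclic permutation.  The fifth
    isolates layers inside an ideal: multiplication by [m] kills all but one. *)
Lemma cycle_brace_simple :
    (forall i, exists j, sg j = i) ->
    (forall P : I -> Prop,
       (exists i, P i) -> (forall j, P (sg j) -> P j) -> forall j, P j) ->
    (exists i : I, True) ->
    (forall i, exists k : R i, k != 0) ->
    (forall i, exists m, (forall w : layer i, w != 0 -> w *+ m != 0) /\
       forall j (w : layer j), j != i -> w *+ m = 0) ->
    (forall i (x : V i), x != 0 -> exists z, polar (quad (D i)) z x != 0) ->
    (forall i (k : R (sg i)), k != 0 ->
       exists y, forall t, exists z, polar (quad (D i)) z (act (D i) k y - y) = t) ->
    (forall i (P : V i -> Prop), P 0 -> (forall x y, P x -> P y -> P (x + y)) ->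
       (forall k y, P (act (D i) k y - y)) -> forall y, P y) ->
  simple_brace cycle_brace.
Proof.
move=> sg_surj sg_cycle [i0 _] nzR sep nondeg unimod span; split.
  have [k k0] := nzR i0; exists (at_layer ((0, k) : layer i0)).
  apply: contra_neq k0 => /(congr1 (fun a : A => (a i0).2)).
  by rewrite at_in zmod_prod0E.
move=> J J_ideal.
have [[a [Ja a0]]|J0] := pselect (exists a, J a /\ a <> 0);
  last first.
  left; apply/seteqP; split=> [a Ja|a ->]; last exact: ideal0.
  by apply: contrapT => a0; apply: J0; exists a.
right; apply/seteqP; split=> // c _.
pose full i := forall t, J (at_layer ((0, t) : layer i)).
have step j (k : R (sg j)) :
    k != 0 -> J (at_layer ((0, k) : layer (sg j))) -> full j.
  move=> k0 Jk t; have [y yP] := unimod j k k0; have [z <-] := yP t.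
  exact: (ideal_polar J_ideal z (ideal_act J_ideal y Jk)).
(* Isolate a nonzero layer, written [sg j] so that [step] applies to it. *)
have start : exists i, full i.
  have [i ai0] : exists i, a i != 0.
    apply: contrapT => nex; apply: a0; apply: zmod_prodP => i.
    by rewrite zmod_prod0E; apply/eqP; apply: contrapT => /negP ai0; apply: nex;
      exists i.
  have [j sj] := sg_surj i; subst i; exists j.
  have [m [m_reg m_kill]] := sep (sg j).
  have : J (at_layer (a (sg j) *+ m)).
    rewrite -(_ : a *+ m = at_layer _); first exact: (idealMn J_ideal m Ja).
    by apply: at_layerP => [|l lj]; rewrite zmod_prodMnE // m_kill.
  move: (m_reg _ ai0); case: (a _ *+ m) => x k xk0 Jxk.
  have [x0|x0] := eqVneq x 0.
    apply: (step j k); last by rewrite -x0.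
    by apply: contra_neq xk0 => ->; rewrite x0.
  have [z zx] := nondeg _ _ x0.
  by apply: (step _ _ zx); have := ideal_polar J_ideal z Jxk.
have next j : full (sg j) -> full j.
  by move=> fj; have [k k0] := nzR (sg j); exact: (step j k k0 (fj k)).
have all_full := sg_cycle full start next.
have all_vec i (y : V i) : J (at_layer ((y, 0) : layer i)).
  move: y; apply: span => [|x y Jx Jy|k y].
  - by rewrite (_ : (0, 0) = 0) // at_layer0; exact: (ideal0 J_ideal).
  - rewrite (_ : (x + y, 0) = ((x, 0) : layer i) + (y, 0)) ?at_layerD.
      exact: (idealD J_ideal).
    by apply: injective_projections; rewrite /= ?addr0.
  - by apply: (ideal_act J_ideal); apply: all_full.
rewrite [c]sum_at_layer; apply: (ideal_sum J_ideal) => i _.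
rewrite (_ : c i = (((c i).1, 0) : layer i) + (0, (c i).2)) ?at_layerD.
  by apply: (idealD J_ideal) => //; apply: all_full.
by apply: injective_projections; rewrite /= ?addr0 ?add0r.
Qed.

End Cycle.

(** * The second elementary symmetric function *)

Section ElementarySymmetric.
Context (K : finType) (R : comNzRingType).
Implicit Types (f g : K -> R) (r : rel K).

Definition pair_sum r f : R := \sum_(p : K * K | r p.1 p.2) f p.1 * f p.2.

Definition tournament r := forall k l, r k l = (k != l) && ~~ r l k.

Lemma sum_swap r f g :
  \sum_(p : K * K | r p.1 p.2) f p.1 * g p.2 =
  \sum_(p : K * K | r p.2 p.1) g p.1 * f p.2.
Proof.
rewrite (reindex (fun p : K * K => (p.2, p.1))) /=; last first.
  by exists (fun p : K * K => (p.2, p.1)) => -[].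
by apply: eq_bigr => p _; rewrite mulrC.
Qed.

(** A tournament selects one of [(k, l)] and [(l, k)] for each pair of distinct
    elements, and the summand does not depend on which one. *)
Lemma pair_sum_tournament r r' f :
  tournament r -> tournament r' -> pair_sum r f = pair_sum r' f.
Proof.
move=> rT rT'; rewrite /pair_sum (bigID (fun p => r' p.1 p.2)) /=.
rewrite [RHS](bigID (fun p => r p.1 p.2)) /=; congr (_ + _).
  by apply: eq_bigl => p; rewrite andbC.
rewrite (sum_swap (fun k l => r k l && ~~ r' k l)); apply: eq_bigl => p /=.
rewrite (rT' p.1) rT -!andbA eq_sym; congr (_ && _).
by rewrite andbC.
Qed.

(** The ranking of [K] serves to count each pair once; dividing a sum over all
    pairs by two would need [2] to be invertible. *)
Definition e2 f : R := pair_sum (fun k l => enum_rank k < enum_rank l)%N f.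

Lemma tournament_rank (T : finType) (h : K -> T) :
  injective h -> tournament (fun k l => enum_rank (h k) < enum_rank (h l))%N.
Proof.
move=> h_inj k l; rewrite -leqNgt ltn_neqAle; congr (~~ _ && _).
by rewrite val_eqE (inj_eq enum_rank_inj) (inj_eq h_inj).
Qed.

Lemma e2_perm (h : K -> K) f : bijective h -> e2 (f \o h) = e2 f.
Proof.
case=> h' hK h'K; rewrite [RHS](@pair_sum_tournament _
  (fun k l => enum_rank (h' k) < enum_rank (h' l))%N).
- rewrite /e2 /pair_sum.
  rewrite [RHS](reindex (fun p : K * K => (h p.1, h p.2))) /=; last first.
    exists (fun p : K * K => (h' p.1, h' p.2)) => -[k l] _ /=;
    by rewrite ?hK ?h'K.
  by apply: eq_bigl => p; rewrite !hK.
- exact: (@tournament_rank K id).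
- exact/tournament_rank/(can_inj h'K).
Qed.

(** The sum of [f k * g l] over distinct [k] and [l] is the product of the sums
    minus the diagonal. *)
Lemma e2D f g :
  e2 (fun k => f k + g k) =
  e2 f + e2 g + ((\sum_k f k) * (\sum_k g k) - \sum_k f k * g k).
Proof.
rewrite mulr_suml [in RHS](eq_bigr _ (fun k _ => mulr_sumr _ _ _ _)).
rewrite pair_big /= (bigID (fun p : K * K => p.1 == p.2)) /=.
rewrite [X in (X + _) - _](_ : _ = \sum_k f k * g k); last first.
  rewrite (reindex (fun k : K => (k, k))) /=; last first.
    by exists fst => [k|[k l] /eqP /= ->].
  by apply: eq_bigl => k; rewrite eqxx.
rewrite [X in _ + (X - _)]addrC addrK.
rewrite (bigID (fun p : K * K => enum_rank p.1 < enum_rank p.2)%N) /=.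
rewrite [X in _ + (_ + X)](_ : _ =
    \sum_(p : K * K | (enum_rank p.1 < enum_rank p.2)%N) g p.1 * f p.2).
  rewrite /e2 /pair_sum [X in _ + (X + _)](eq_bigl
    (fun p : K * K => (enum_rank p.1 < enum_rank p.2)%N)) => [|p].
    rewrite -!big_split /=; apply: eq_bigr => p _.
    rewrite mulrDl !mulrDr -!addrA; congr (_ + _); rewrite addrC -!addrA addrC.
    by rewrite -!addrA.
  by rewrite andb_idl // => /ltn_eqF; apply: contraFN => /eqP ->.
rewrite -(sum_swap (fun k l => (enum_rank l < enum_rank k)%N)).
apply: eq_bigl => p; rewrite -leqNgt [RHS]ltn_neqAle.
by rewrite val_eqE (inj_eq enum_rank_inj) eq_sym.
Qed.

End ElementarySymmetric.

(** * Zero-sum functions *)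

Section ZeroSum.
Context (T : finType) (K : finZmodType) (R : comNzRingType).

Definition zero_sum_pred : {pred {ffun T * K -> R}} :=
  fun x => [forall t, \sum_k x (t, k) == 0].

Fact zero_sum_zmod : zmod_closed zero_sum_pred.
Proof.
split=> [|x y /forallP x0 /forallP y0]; apply/forallP => t.
  by rewrite big1 // => k _; rewrite ffunE.
under eq_bigr do rewrite !ffunE.
by rewrite sumrB (eqP (x0 t)) (eqP (y0 t)) subrr.
Qed.

HB.instance Definition _ :=
  GRing.isZmodClosed.Build {ffun T * K -> R} zero_sum_pred zero_sum_zmod.

Record zero_sum := ZeroSum {
  zs_val :> {ffun T * K -> R};
  _ : zs_val \in zero_sum_pred
}.

HB.instance Definition _ := [isSub for zs_val].
HB.instance Definition _ := [Choice of zero_sum by <:].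
HB.instance Definition _ := [SubChoice_isSubZmodule of zero_sum by <:].

Implicit Types (x y z : zero_sum) (t : T) (k l : K) (c : R).

Lemma zero_sumP x y : (forall p, x p = y p) -> x = y.
Proof. by move=> xy; apply/val_inj/ffunP. Qed.

Lemma sum_zero_sum x t : \sum_k x (t, k) = 0.
Proof. by case: x => x /= /forallP/(_ t)/eqP. Qed.

Lemma zero_sum0E p : (0 : zero_sum) p = 0.
Proof. by rewrite [zs_val _](_ : _ = 0) // ffunE. Qed.

Lemma zero_sumDE x y p : (x + y) p = x p + y p.
Proof. by rewrite [zs_val _](_ : _ = zs_val x + zs_val y) // ffunE. Qed.

Lemma zero_sumNE x p : (- x) p = - x p.
Proof. by rewrite [zs_val _](_ : _ = - zs_val x) // ffunE. Qed.

Lemma zero_sumMnE x n p : (x *+ n) p = x p *+ n.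
Proof.
by elim: n => [|n IHn]; rewrite ?mulr0n ?zero_sum0E // !mulrS zero_sumDE IHn.
Qed.

Fact zs_act_subproof k x :
  [ffun p : T * K => x (p.1, p.2 + k)] \in zero_sum_pred.
Proof.
apply/forallP => t; under eq_bigr do rewrite ffunE.
by rewrite -[X in _ == X](sum_zero_sum x t) [X in _ == X](reindex_inj (addIr k)).
Qed.

Definition zs_act k x := ZeroSum (zs_act_subproof k x).

Lemma zs_actE k x p : zs_act k x p = x (p.1, p.2 + k).
Proof. exact: ffunE. Qed.

Definition zs_quad x : R := \sum_t e2 (fun k => x (t, k)).

(** In [e2D] the product of the two sums vanishes. *)
Lemma zs_polarE x y : polar zs_quad x y = - \sum_p x p * y p.
Proof.
have -> : \sum_p x p * y p = \sum_t \sum_k x (t, k) * y (t, k).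
  by rewrite pair_big; apply: eq_bigr => -[].
rewrite /polar /zs_quad -!sumrB -sumrN; apply: eq_bigr => t _.
rewrite [e2 _](_ : _ = e2 (fun k => x (t, k) + y (t, k))); last first.
  by apply: eq_bigr => p _; rewrite !zero_sumDE.
rewrite e2D !sum_zero_sum mul0r sub0r.
by rewrite -[LHS]addrA -opprD addrAC subrr sub0r.
Qed.

Fact zs_polarDr x y z :
  polar zs_quad x (y + z) = polar zs_quad x y + polar zs_quad x z.
Proof.
rewrite !zs_polarE -opprD -big_split /=; congr (- _); apply: eq_bigr => p _.
by rewrite zero_sumDE mulrDr.
Qed.

Fact zs_act0 x : zs_act 0 x = x.
Proof. by apply: zero_sumP => -[t k]; rewrite zs_actE addr0. Qed.

Fact zs_actD k l x : zs_act (k + l) x = zs_act k (zs_act l x).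
Proof. by apply: zero_sumP => p; rewrite !zs_actE addrA. Qed.

Fact zs_act_add k x y : zs_act k (x + y) = zs_act k x + zs_act k y.
Proof. by apply: zero_sumP => p; rewrite zs_actE !zero_sumDE !zs_actE. Qed.

Fact zs_quad_act k x : zs_quad (zs_act k x) = zs_quad x.
Proof.
apply: eq_bigr => t _.
rewrite -[RHS](e2_perm _ (_ : bijective (fun l => l + k))).
  by apply: eq_bigr => p _; rewrite !zs_actE.
by exists (fun l => l - k) => l; rewrite ?addrK ?subrK.
Qed.

Definition zs_action : isometric_action K zero_sum R :=
  IsometricAction zs_polarDr zs_act0 zs_actD zs_act_add zs_quad_act.

End ZeroSum.

Section ZeroSumUnit.
Context (T : finType) (K : finZmodType) (R : comUnitRingType).
Context (unitK : (#|K|%:R : R) \is a GRing.unit).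
Local Notation V := (zero_sum T K R).
Implicit Types (x y z : V) (t : T) (k l : K) (c : R).

(** The function [c] at [p] and [0] elsewhere, minus its mean on the fibre of [p]. *)
Fact bump_subproof (p : T * K) c :
  [ffun q : T * K => if q.1 == p.1 then (q.2 == p.2)%:R * c - c / #|K|%:R else 0]
    \in @zero_sum_pred T K R.
Proof.
apply/forallP => t; under eq_bigr do rewrite ffunE /=.
have [_|_] := eqVneq t p.1; last by rewrite big1.
rewrite sumrB sumr_const (bigD1 p.2) //= eqxx mul1r big1 => [|k /negPf->].
  by rewrite -[_ *+ _]mulr_natr mulrVK // addr0 subrr.
by rewrite mul0r.
Qed.

Definition bump p c : V := ZeroSum (bump_subproof p c).

(** The mean is orthogonal to zero-sum functions, so [bump] detects coordinates. *)
Lemma polar_bump p c x : polar (quad (zs_action T K R)) (bump p c) x = - (c * x p).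
Proof.
rewrite zs_polarE; congr (- _).
have -> : \sum_q bump p c q * x q = \sum_t \sum_k bump p c (t, k) * x (t, k).
  by rewrite pair_big; apply: eq_bigr => -[].
rewrite (bigD1 p.1) //= [X in _ + X]big1 => [|t tp]; last first.
  by rewrite big1 // => k _; rewrite ffunE /= (negPf tp) mul0r.
under eq_bigr do rewrite ffunE /= eqxx mulrBl.
rewrite sumrB -mulr_sumr sum_zero_sum mulr0 subr0 addr0 (bigD1 p.2) //=.
rewrite eqxx mul1r big1 => [|k /negPf->]; last by rewrite !mul0r.
by rewrite addr0 -surjective_pairing.
Qed.

Lemma zs_nondegenerate x :
  x != 0 -> exists z, polar (quad (zs_action T K R)) z x != 0.
Proof.
move=> x0; have [p xp] : exists p, x p != 0.
  apply/existsP; apply: contraNT x0 => /existsPn x0; apply/eqP/zero_sumP => p.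
  by rewrite zero_sum0E; apply/eqP; have := x0 p; rewrite negbK.
by exists (bump p 1); rewrite polar_bump mul1r oppr_eq0.
Qed.

(** Moving the bump at [0] by a nonzero [k] changes its value at [0] by [-1],
    whatever the mean. *)
Lemma zs_unimodular (t0 : T) k : k != 0 ->
  exists y, forall c, exists z,
    polar (quad (zs_action T K R)) z (act (zs_action T K R) k y - y) = c.
Proof.
move=> k0; exists (bump (t0, 0) 1) => c; exists (bump (t0, 0) c).
rewrite polar_bump zero_sumDE zero_sumNE zs_actE !ffunE /= eqxx add0r eqxx.
by rewrite (negPf k0) mul0r sub0r !mul1r opprB addKr mulrN1 opprK.
Qed.

(** Summing [k y - y] over [K] gives [- #|K| y], since the translates of [y] sum to
    zero; hence [y] is the sum of these differences for [y' = - y / #|K|]. *)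
Lemma zs_spanned (P : V -> Prop) :
    P 0 -> (forall x y, P x -> P y -> P (x + y)) ->
    (forall k y, P (act (zs_action T K R) k y - y)) ->
  forall y, P y.
Proof.
move=> P0 PD Pact y.
have y'_sum : [ffun p => - (y p / #|K|%:R)] \in @zero_sum_pred T K R.
  apply/forallP => t; under eq_bigr do rewrite ffunE.
  by rewrite sumrN -mulr_suml sum_zero_sum mul0r oppr0.
pose y' : V := ZeroSum y'_sum.
suff -> : y = \sum_k (act (zs_action T K R) k y' - y').
  by apply: big_ind => // k _; apply: Pact.
apply: zero_sumP => -[t j].
rewrite (big_morph (fun x : V => x (t, j)) (fun x z => zero_sumDE x z (t, j))
  (zero_sum0E R (t, j))).
under eq_bigr do rewrite zero_sumDE zero_sumNE zs_actE /=.
rewrite sumrB sumr_const.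
rewrite -(@reindex_inj _ _ _ _ _ predT (fun k => y' (t, k)) (addrI j)).
rewrite sum_zero_sum sub0r.
by rewrite ffunE mulNrn opprK -[RHS]mulr_natr mulrVK.
Qed.

End ZeroSumUnit.

(** * Additive structure of the layers *)

Lemma zmod_isomorphic_of (U V : zmodType) (f : U -> V) (g : V -> U) :
  (forall x y, f (x - y) = f x - f y) -> injective f -> cancel g f ->
  zmod_isomorphic U V.
Proof.
move=> fB f_inj gK.
pose F : {additive U -> V} := HB.pack f (GRing.isZmodMorphism.Build U V f fB).
by exists F; exists g => // x; apply: f_inj; rewrite gK.
Qed.

Lemma zmod_prod_isomorphic (I : finType) (U V : I -> zmodType) :
  (forall i, zmod_isomorphic (U i) (V i)) ->
  zmod_isomorphic (zmod_prod U) (zmod_prod V).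
Proof.
move=> UV; pose f i := projT1 (cid (UV i)).
have f_bij i : bijective (f i) := projT2 (cid (UV i)).
have g_ex i : exists g, cancel g (f i) by case: (f_bij i) => g _; exists g.
pose g i := projT1 (cid (g_ex i)).
have gK i : cancel (g i) (f i) := projT2 (cid (g_ex i)).
apply: (@zmod_isomorphic_of (zmod_prod U) (zmod_prod V)
  (fun u => [ffun i => f i (u i)] : zmod_prod V)
  (fun v => [ffun i => g i (v i)] : zmod_prod U)).
- by move=> x y; apply/ffunP => i; rewrite !ffunE raddfB.
- move=> x y /ffunP xy; apply/ffunP => i; apply: (bij_inj (f_bij i)).
  by have := xy i; rewrite !ffunE.
- by move=> v; apply/ffunP => i; rewrite !ffunE gK.
Qed.

Section ZeroSumLayer.
Context (T : finType) (K : finZmodType) (R : comUnitRingType).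
Local Notation V := (zero_sum T K R).

(** A zero-sum function is determined by its values at the nonzero [k], which are
    arbitrary. *)
Lemma zero_sum_layer_iso n :
  (#|T| * (#|K| - 1) + 1)%N = n -> zmod_isomorphic (V * R)%type 'rV[R]_n.
Proof.
pose J := option (T * {k : K | k != 0}) => cardn.
have cardJ : n = #|{: J}|.
  rewrite card_option card_prod card_sig -cardn addn1 subn1 -(cardC1 (0 : K)).
  by congr (_ * _).+1; apply: eq_card.
pose e (i : 'I_n) : J := enum_val (cast_ord cardJ i).
pose e' (o : J) : 'I_n := cast_ord (esym cardJ) (enum_rank o).
have eK : cancel e e' by move=> i; rewrite /e /e' enum_valK cast_ordK.
have e'K : cancel e' e by move=> o; rewrite /e /e' cast_ordKV enum_rankK.
pose coord (w : V * R) (o : J) : R :=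
  if o is Some q then w.1 (q.1, val q.2) else w.2.
pose g (v : 'rV[R]_n) (t : T) (k : K) : R :=
  v ord0 (e' (omap (pair t) (insub k))).
(* The values of [g] at [k = 0] are junk: subtracting the fibre sum at [0]
   corrects them, whatever they are. *)
have x_sum v : [ffun p : T * K => g v p.1 p.2 -
    (p.2 == 0)%:R * \sum_l g v p.1 l] \in @zero_sum_pred T K R.
  apply/forallP => t; under eq_bigr do rewrite ffunE /=.
  rewrite sumrB -mulr_suml [X in _ - X * _](_ : _ = 1) ?mul1r ?subrr //.
  by rewrite (bigD1 (0 : K)) //= eqxx big1 ?addr0 // => k /negPf->.
apply: (@zmod_isomorphic_of _ _ (fun w => \row_i coord w (e i))
  (fun v => (ZeroSum (x_sum v), v ord0 (e' None)))).
- move=> x y; apply/rowP => i; rewrite !mxE /coord; case: (e i) => [q|] //=.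
  exact: (etrans (zero_sumDE _ _ _) (congr1 _ (zero_sumNE _ _))).
- move=> [x m] [y m'] /rowP xy.
  have {}xy o : coord (x, m) o = coord (y, m') o.
    by have := xy (e' o); rewrite !mxE e'K.
  apply: injective_projections; last exact: (xy None).
  have xy1 t k : k != 0 -> x (t, k) = y (t, k).
    by move=> k0; apply: (xy (Some (t, exist _ k k0))).
  apply: zero_sumP => -[t k]; have [->|/xy1//] := eqVneq k 0.
  apply: (addIr (\sum_(l | l != 0) x (t, l))).
  rewrite [in RHS](eq_bigr _ (fun l => xy1 t l)).
  have sum0 (z : V) : z (t, 0) + \sum_(l | l != 0) z (t, l) = 0.
    by rewrite -[RHS](sum_zero_sum z t) [RHS](bigD1 (0 : K)).
  by rewrite !sum0.
- move=> v; apply/rowP => i; rewrite mxE /coord -[in RHS](eK i).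
  case: (e i) => [[t k]|] //=; rewrite ffunE /= (negPf (valP k)) mul0r subr0.
  by rewrite /g valK.
Qed.

Lemma layer_kill m (w : V * R) : m%:R = 0 :> R -> w *+ m = 0.
Proof.
move=> m0; have kill (c : R) : c *+ m = 0 by rewrite -mulr_natr m0 mulr0.
apply: injective_projections; rewrite raddfMn //= ?kill //.
by apply: zero_sumP => p; rewrite zero_sumMnE kill zero_sum0E.
Qed.

Lemma layer_regular m (w : V * R) :
  (m%:R : R) \is a GRing.unit -> w != 0 -> w *+ m != 0.
Proof.
move=> mU; apply: contra_neq => wm.
have reg (c : R) : c *+ m = 0 -> c = 0.
  by rewrite -mulr_natr => cm; rewrite -[c](mulrK mU) cm mul0r.
apply: injective_projections.
  apply: zero_sumP => p; rewrite zero_sum0E; apply: reg.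
  by rewrite -zero_sumMnE -raddfMn wm zero_sum0E.
by apply: reg; rewrite -raddfMn wm.
Qed.

End ZeroSumLayer.

Lemma ordS_cycle s (P : 'I_s -> Prop) :
  (exists i, P i) -> (forall j, P (ordS j) -> P j) -> forall j, P j.
Proof.
move=> [i Pi] Pdown j.
have iterS d (k : 'I_s) : iter d (@ordS s) k = ((k + d) %% s)%N :> nat.
  elim: d => [|d IHd]; first by rewrite addn0 modn_small.
  by rewrite /= IHd -addn1 modnDml addn1 addnS.
have Piter d (k : 'I_s) : P (iter d (@ordS s) k) -> P k.
  by elim: d => // d IHd /Pdown/IHd.
apply: (Piter (i + (s - j))%N); rewrite (_ : iter _ _ _ = i) //.
apply: val_inj; rewrite /= iterS addnCA subnKC; last exact/ltnW.
by rewrite modnDr modn_small.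
Qed.

(** * Simple braces from distinct primes *)

Lemma Zp_natr0 n m : (1 < n)%N -> (n %| m)%N -> m%:R = 0 :> 'Z_n.
Proof.
move=> n1 /dvdnP[c ->]; apply: val_inj.
by rewrite [LHS]val_Zp_nat // modnMl.
Qed.

Theorem mainTheorem5 (s : nat) (p r r' : 'I_s -> nat)
  (s_gt1 : (1 < s)%N)
  (p_prime : forall i, prime (p i))
  (p_inj : injective p)
  (p_odd : forall i : 'I_s, (i.+1 < s)%N -> odd (p i))
  (r_gt0 : forall i, (0 < r i)%N)
  (r_last : forall i : 'I_s, i.+1 = s -> p i = 2%N -> r i = 1%N)
  (r'_le : forall i, (r' i <= r i)%N) :
  exists B : leftBraceType,
    simple_brace B /\
    zmod_isomorphic B
      (zmod_prod (fun i : 'I_s =>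
        'rV['Z_(p i ^ r i)]_(p i ^ r' i * (p (ordS i) ^ r (ordS i) - 1) + 1))).
Proof.
pose n i := (p i ^ r i)%N.
have n_gt1 i : (1 < n i)%N by rewrite -(exp1n (r i)) ltn_exp2r ?prime_gt1.
have n_coprime i j : i != j -> coprime (n i) (n j).
  move=> ij; apply/coprimeXl/coprimeXr.
  by rewrite prime_coprime // dvdn_prime2 // (inj_eq p_inj).
have ordS_neq (i : 'I_s) : i != ordS i.
  rewrite -val_eqE /=; case: (ltnP i.+1 s) => [iS|sS].
    by rewrite modn_small // ltn_eqF.
  have iS : i.+1 = s by apply/eqP; rewrite eqn_leq sS andbT.
  rewrite iS modnn; apply: contraL s_gt1 => /eqP i0.
  by rewrite -iS i0.
pose T i : finType := 'I_(p i ^ r' i).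
pose V i : zmodType := zero_sum (T i) 'Z_(n (ordS i)) 'Z_(n i).
pose R i : zmodType := 'Z_(n i).
pose D i : isometric_action (R (ordS i)) (V i) (R i) :=
  zs_action (T i) 'Z_(n (ordS i)) 'Z_(n i).
have cardZ i : #|'Z_(n i)| = n i by rewrite card_ord Zp_cast.
have unitK i : (#|'Z_(n (ordS i))|%:R : 'Z_(n i)) \is a GRing.unit.
  by rewrite cardZ unitZpE ?n_coprime.
exists (cycle_brace D); split.
  apply: cycle_brace_simple.
  - by move=> i; exists (ord_pred i); rewrite ord_predK.
  - exact: ordS_cycle.
  - by exists (Ordinal (ltnW s_gt1)).
  - by move=> i; exists (1 : 'Z_(n i)); apply: oner_neq0.
  - move=> i; exists (\prod_(j | j != i) n j)%N; split=> [w|j w ji].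
      apply: layer_regular; rewrite unitZpE //.
      elim/big_ind: _ => [|x y cx cy|j ji]; first exact: coprimen1.
        by rewrite coprimeMr cx.
      by rewrite n_coprime // eq_sym.
    apply: layer_kill; apply: Zp_natr0 => //.
    by rewrite (bigD1 j) //= dvdn_mulr.
  - by move=> i x; apply: (zs_nondegenerate (unitK i)).
  - have T_gt0 i : (0 < p i ^ r' i)%N by rewrite expn_gt0 prime_gt0.
    by move=> i k; apply: (zs_unimodular (unitK i) (Ordinal (T_gt0 i))).
  - by move=> i P; apply: (zs_spanned (unitK i)).
apply: (@zmod_prod_isomorphic _ (layer V R)) => i.
by apply: zero_sum_layer_iso; rewrite card_ord cardZ.
Qed.
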